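(* Let $T$ be a countable set of transitions, let $\mathcal{H}$ be the set of all finite sequences over $T$ (including the empty sequence $\varepsilon$), let $\succsim$ be a binary relation on $\Delta(\mathcal{H})$, and let $\gamma : T \to [0,1]$. Then $\succsim$ satisfies Completeness, Transitivity, Independence, Continuity, and Temporal $\gamma$-Indifference (with this function $\gamma$) if and only if there exist a utility function $u : \Delta(\mathcal{H}) \to \mathbb{R}$ and a reward function $r : T \to \mathbb{R}$ such that $u(\varepsilon) = 0$, $$u(t \cdot h) = r(t) + \gamma(t)\, u(h) \quad \text{for all } t \in T,\ h \in \mathcal{H},$$ and 1. for all $A, B \in \Delta(\mathcal{H})$, $A \succsim B \iff u(A) \ge u(B)$; 2. for all $\sum_i p_i h_i \in \Delta(\mathcal{H})$, $u\left(\sum_i p_i h_i\right) = \sum_i p_i u(h_i)$. Moreover, in this case $r$ is unique up to a positive scale factor: if $(u,r)$ and $(u',r')$ are two pairs, each consisting of a function $\Delta(\mathcal{H}) \to \mathbb{R}$ and a function $T \to \mathbb{R}$, such that $u(\varepsilon) = u'(\varepsilon) = 0$; $u(t \cdot h) = r(t) + \gamma(t)\, u(h)$ and $u'(t \cdot h) = r'(t) + \gamma(t)\, u'(h)$ for all $t \in T$, $h \in \mathcal{H}$; for all $A, B \in \Delta(\mathcal{H})$, $A \succsim B \iff u(A) \ge u(B) \iff u'(A) \ge u'(B)$; and $u\left(\sum_i p_i h_i\right) = \sum_i p_i u(h_i)$ and $u'\left(\sum_i p_i h_i\right) = \sum_i p_i u'(h_i)$ for all $\sum_i p_i h_i \in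 \Delta(\mathcal{H})$, then there is $c > 0$ with $r' = c\, r$.
   Context: $\Delta(\mathcal{H})$ is the set of finitely supported probability distributions on $\mathcal{H}$; a history $h\in\mathcal{H}$ is identified with the Dirac distribution at $h$. For $A,B\in\Delta(\mathcal{H})$ and $p\in[0,1]$, $pA+(1-p)B$ is the mixture, and $\sum_i p_i h_i$ denotes the distribution giving probability $p_i$ to $h_i$. For $t\in T$ and $h \in \mathcal{H}$, $t\cdot h$ is $h$ with $t$ prepended; for $A \in \Delta(\mathcal{H})$, $t\cdot A$ is the distribution of $t\cdot h$ with $h$ sampled from $A$. Write $A\sim B$ when $A\succsim B$ and $B\succsim A$. The axioms on $\succsim$ are: (1) Completeness: for all $A,B\in\Delta(\mathcal{H})$, $A\succsim B$ or $B\succsim A$. (2) Transitivity: for all $A,B,C \in \Delta(\mathcal{H})$, $A\succsim B\succsim C$ implies $A\succsim C$. (3) Independence: for all $A,B,C \in \Delta(\mathcal{H})$ and $p\in(0,1)$, $A\succsim B$ if and only if $pA+(1-p)C\succsim pB+(1-p)C$. (4) Continuity: for all $A,B,C \in \Delta(\mathcal{H})$, if $A\succsim B\succsim C$ then there exists $p\in[0,1]$ such that $pA+(1-p)C\sim B$. (5) Temporal $\gamma$-Indifference, for a function $\gamma: T\to[0,1]$: for all $A,B\in\Delta(\mathcal{H})$ and $t\in T$, $$\tfrac{1}{\gamma(t)+1}(t\cdot A)+\tfrac{\gamma(t)}{\gamma(t)+1}B\sim\tfrac{1}{\gamma(t)+1}(t\cdot B)+\tfrac{\gamma(t)}{\gamma(t)+1}A.$$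 *)

(* Defs.v *)
From HB Require Import structures.
From mathcomp Require Import all_boot all_order all_algebra.
From mathcomp Require Import finmap.
From mathcomp Require Import reals.

Set Implicit Arguments.
Unset Strict Implicit.
Unset Printing Implicit Defensive.

Import Order.TTheory GRing.Theory Num.Theory.
Local Open Scope fset_scope.
Local Open Scope ring_scope.

Section FinitelySupportedDistributions.
Variables (R : realType) (K : choiceType).

Definition is_fdist (f : {fsfun K -> R with 0}) : bool :=
  all (fun x => 0 <= f x) (finsupp f) && (\sum_(x <- finsupp f) f x == 1).

(* The side condition is boolean, hence proof-irrelevant, and finitely
   supported functions are extensional: Leibniz equality on [fdist] is equality
   of distributions. *)
Record fdist := FDist {
  fdist_fun :> {fsfun K -> R with 0};
  fdistP : is_fdist fdist_fun }.

HB.instance Definition _ := [isSub for fdist_fun].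

Lemma fdist_ge0 (A : fdist) x : 0 <= A x.
Proof.
have /andP[/allP A0 _] := fdistP A.
by case: finsuppP => // xA; apply: A0.
Qed.

Lemma fdist_sum1 (A : fdist) : \sum_(x <- finsupp A) A x = 1.
Proof. by have /andP[_ /eqP] := fdistP A. Qed.

Lemma fdist_ext (A B : fdist) : (forall x, A x = B x) -> A = B.
Proof. by move=> AB; apply/val_inj/fsfunP. Qed.

Lemma sum_finsupp1 (f : {fsfun K -> R with 0}) (S : {fset K}) :
  finsupp f `<=` S -> \sum_(x <- S) f x = \sum_(x <- finsupp f) f x.
Proof.
by move=> fS; rewrite (big_fset_incl _ fS) // => x _ xf; rewrite fsfun_dflt.
Qed.

Section Build.
Variables (S : {fset K}) (F : K -> R).
Hypothesis F_ge0 : forall x, 0 <= F x.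
Hypothesis F_sum1 : \sum_(x <- S) F x = 1.

Definition fdist_fsfun : {fsfun K -> R with 0} := [fsfun x in S => F x].

Lemma fdist_fsfunP : is_fdist fdist_fsfun.
Proof.
apply/andP; split.
  by apply/allP => x _; rewrite fsfun_fun; case: ifP.
rewrite -(@sum_finsupp1 _ S) ?finsupp_sub // -F_sum1; apply/eqP.
by apply: eq_big_seq => x xS; rewrite fsfun_fun xS.
Qed.

Definition build_fdist : fdist := FDist fdist_fsfunP.

Lemma build_fdistE x : build_fdist x = if x \in S then F x else 0.
Proof. by rewrite /= fsfun_fun. Qed.
End Build.

Section Dirac.
Variable a : K.

Lemma dirac_ge0 x : 0 <= (x == a)%:R :> R.
Proof. exact: ler0n. Qed.

Lemma dirac_sum1 : \sum_(x <- [fset a]) (x == a)%:R = 1 :> R.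
Proof. by rewrite big_seq_fset1 eqxx. Qed.

Definition dirac : fdist := build_fdist dirac_ge0 dirac_sum1.

Lemma diracE x : dirac x = (x == a)%:R.
Proof. by rewrite build_fdistE inE; case: eqP. Qed.
End Dirac.

Definition weights (p q : R) : bool := [&& 0 <= p, 0 <= q & p + q == 1].

Section Mixture.
Variables (p q : R) (pq : weights p q) (A B : fdist).

Lemma mix_ge0 x : 0 <= p * A x + q * B x.
Proof.
by have /and3P[p0 q0 _] := pq; rewrite addr_ge0 // mulr_ge0 // fdist_ge0.
Qed.

Lemma mix_sum1 :
  \sum_(x <- finsupp A `|` finsupp B) (p * A x + q * B x) = 1.
Proof.
rewrite big_split /= -!mulr_sumr !sum_finsupp1 ?fsubsetUl ?fsubsetUr //.
by rewrite !fdist_sum1 !mulr1; have /and3P[_ _ /eqP] := pq.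
Qed.

Definition mix : fdist := build_fdist mix_ge0 mix_sum1.

Lemma mixE x : mix x = p * A x + q * B x.
Proof.
rewrite build_fdistE in_fsetU; case: ifP => // /negbT.
by rewrite negb_or => /andP[xA xB]; rewrite !fsfun_dflt // !mulr0 addr0.
Qed.
End Mixture.
End FinitelySupportedDistributions.

Arguments mix {R K p q} pq A B.
Arguments dirac R {K} a.

Section Pushforward.
Variables (R : realType) (K L : choiceType) (f : K -> L) (A : fdist R K).

Lemma push_ge0 y : 0 <= \sum_(x <- finsupp A | f x == y) A x.
Proof. by apply: sumr_ge0 => x _; apply: fdist_ge0. Qed.

Lemma push_sum1 :
  \sum_(y <- f @` finsupp A) \sum_(x <- finsupp A | f x == y) A x = 1.
Proof.
rewrite (exchange_big_dep predT) //= -[RHS](fdist_sum1 A).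
apply: eq_big_seq => x xA.
rewrite big_mkcond (big_fsetD1 (f x)) ?in_imfset //= eqxx big_seq big1 ?addr0 //.
by move=> y; rewrite !inE eq_sym => /andP[/negPf->].
Qed.

Definition push : fdist R L := build_fdist push_ge0 push_sum1.

Lemma pushE y : push y = \sum_(x <- finsupp A | f x == y) A x.
Proof.
rewrite build_fdistE; case: ifP => // /negbT yfA.
rewrite big_seq_cond big1 // => x /andP[xA /eqP fxy].
by case/negP: yfA; rewrite -fxy in_imfset.
Qed.
End Pushforward.

Section Weights.
Variables (R : realType) (p g : R).

Lemma weights_cc : 0 <= p <= 1 -> weights p (1 - p).
Proof.
by case/andP=> p0 p1; rewrite /weights p0 subr_ge0 p1 addrC subrK eqxx.
Qed.

Lemma weights_oo : 0 < p < 1 -> weights p (1 - p).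
Proof. by case/andP=> /ltW p0 /ltW p1; apply: weights_cc; rewrite p0. Qed.

Lemma weights_discount :
  0 <= g <= 1 -> weights (1 / (g + 1)) (g / (g + 1)).
Proof.
case/andP=> g0 _; have g1 : 0 < g + 1 by rewrite ltr_wpDl.
rewrite /weights !divr_ge0 ?(ltW g1) //= -mulrDl addrC divff //.
by rewrite gt_eqF.
Qed.
End Weights.

Section Preferences.
Variables (R : realType) (T : countType).

Definition lottery : Type := fdist R (seq T).

Definition prepend (t : T) (A : lottery) : lottery := push (cons t) A.

Variable pref : lottery -> lottery -> Prop.

Definition indiff (A B : lottery) : Prop := pref A B /\ pref B A.

Definition completeness : Prop := forall A B, pref A B \/ pref B A.

Definition transitivity : Prop :=
  forall A B C, pref A B -> pref B C -> pref A C.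

Definition independence : Prop :=
  forall A B C (p : R) (p01 : 0 < p < 1),
    pref A B <-> pref (mix (weights_oo p01) A C) (mix (weights_oo p01) B C).

Definition continuity : Prop :=
  forall A B C, pref A B -> pref B C ->
    exists (p : R) (p01 : 0 <= p <= 1), indiff (mix (weights_cc p01) A C) B.

Definition temporal_indifference (gamma : T -> R)
    (gamma01 : forall t, 0 <= gamma t <= 1) : Prop :=
  forall A B t,
    let w := weights_discount (gamma01 t) in
    indiff (mix w (prepend t A) B) (mix w (prepend t B) A).

(* [u] is defined on lotteries, a history being identified with its Dirac
   lottery.  The canonical expression of a lottery [A] as a formal sum
   [\sum_i p_i h_i] has the points [h] of its support as the [h_i], with
   [p_i = A h]. *)
Record utility_reward (gamma : T -> R) (u : lottery -> R) (r : T -> R) :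
    Prop := UtilityReward {
  utility_nil : u (dirac R [::]) = 0;
  utility_cons : forall (t : T) (h : seq T),
    u (dirac R (t :: h)) = r t + gamma t * u (dirac R h);
  utility_pref : forall A B, pref A B <-> u A >= u B;
  utility_sum : forall A : lottery,
    u A = \sum_(h <- finsupp A) A h * u (dirac R h) }.
End Preferences.

Arguments temporal_indifference {R T} pref {gamma} gamma01.

(* Main.v *)
(** Scaling the differences [A - B] with [A] preferred to [B] gives a cone of
    zero-mass signed measures; by independence it is a well-defined convex cone,
    total on differences of lotteries.  If [a] is strictly preferred to [b],
    continuity places every [C - b] on the line spanned by [a - b] modulo the
    lineality space of the cone; the coordinate [u C] on that line is the
    von Neumann-Morgenstern utility, and it is linear because the cone is
    convex.  Temporal indifference between [h] and [h'] then says exactly that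
    [u (t :: h) - gamma t * u h] does not depend on [h].
    For uniqueness, mixing [A] and [B] with weights proportional to [|u B|] and
    [|u A|], together or each with the empty history, produces indifferent
    lotteries, on which any other utility must agree. *)
Require Import Defs.
From mathcomp Require Import all_boot all_order all_algebra.
From mathcomp Require Import finmap boolp ring lra.
From mathcomp Require Import reals.

Set Implicit Arguments.
Unset Strict Implicit.
Unset Printing Implicit Defensive.

Import Order.TTheory GRing.Theory Num.Theory.
Local Open Scope ring_scope.

(** * Expectations under finitely supported distributions *)

Section Expectation.
Variables (R : realType) (K : choiceType).
Implicit Types (A B : fdist R K) (f : K -> R).

Definition expect f A : R := \sum_(h <- finsupp A) A h * f h.

(** Distributions with different supports can then be summed over one common finite set. *)
Lemma expect_widen f A (S : {fset K}) :
  (finsupp A `<=` S)%fset -> expect f A = \sum_(h <- S) A h * f h.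
Proof.
move=> AS; rewrite /expect (big_fset_incl _ AS) // => x _ xA.
by rewrite fsfun_dflt ?mul0r.
Qed.

Lemma expect_dirac f h : expect f (dirac R h) = f h.
Proof.
have hS : (finsupp (dirac R h) `<=` [fset h])%fset.
  apply/fsubsetP => x; rewrite mem_finsupp diracE inE.
  by case: (x == h) => //; rewrite eqxx.
by rewrite (expect_widen _ hS) big_seq_fset1 diracE eqxx mul1r.
Qed.

Lemma expect_mix f p q (w : weights p q) A B :
  expect f (mix w A B) = p * expect f A + q * expect f B.
Proof.
have ABS : (finsupp (mix w A B) `<=` finsupp A `|` finsupp B)%fset.
  exact: finsupp_sub.
rewrite (expect_widen _ ABS) (expect_widen f (fsubsetUl (finsupp A) (finsupp B))).
rewrite (expect_widen f (fsubsetUr (finsupp A) (finsupp B))).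
rewrite !mulr_sumr -big_split /=; apply: eq_bigr => h _.
by rewrite -/(mix w A B h) (mixE w); ring.
Qed.

(** Used to reduce the coordinate of a lottery to those of the histories in its support. *)
Lemma fdist_dirac_sum A x : A x = \sum_(h <- finsupp A) A h * dirac R h x.
Proof.
transitivity (expect (fun h => (x == h)%:R) A); last first.
  by apply: eq_bigr => h _; rewrite diracE.
case: (boolP (x \in finsupp A)) => xA; rewrite /expect.
  rewrite (big_fsetD1 x) //= eqxx mulr1 big_seq big1 ?addr0 // => y.
  by rewrite !inE eq_sym => /andP[/negPf-> _]; rewrite mulr0.
rewrite fsfun_dflt // big_seq big1 // => y yA.
by case: eqP xA => [->|]; rewrite ?yA ?mulr0.
Qed.

End Expectation.

Lemma expect_push (R : realType) (K L : choiceType) (g : K -> L) (f : L -> R)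
    (A : fdist R K) :
  expect f (push g A) = expect (f \o g) A.
Proof.
have gS : (finsupp (push g A) `<=` [fset g x | x in finsupp A])%fset.
  exact: finsupp_sub.
rewrite (expect_widen _ gS).
under eq_bigr do rewrite -/(push g A _) pushE mulr_suml.
rewrite (exchange_big_dep predT) //=.
apply: eq_big_seq => x xA.
rewrite big_mkcond (big_fsetD1 (g x)) ?in_imfset //= eqxx big_seq big1 ?addr0 //.
by move=> y; rewrite !inE eq_sym => /andP[/negPf->].
Qed.

Lemma prepend_dirac (R : realType) (T : countType) (t : T) (h : seq T) :
  prepend t (dirac R h) = dirac R (t :: h).
Proof.
apply: fdist_ext => y; rewrite pushE diracE big_mkcond /=.
rewrite -[RHS](expect_dirac (fun x => (y == t :: x)%:R)); apply: eq_bigr => x _.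
by rewrite eq_sym; case: eqP => _; rewrite ?mulr1 ?mulr0.
Qed.

(** * The convex cone of a preference relation *)

Section PositiveCone.
Variables (R : realType) (T : countType).
Variable pref : lottery R T -> lottery R T -> Prop.
Hypotheses (pref_total : completeness pref) (pref_trans : transitivity pref)
  (pref_indep : independence pref).
Implicit Types (A B C : lottery R T) (v w : seq T -> R).

Definition cone v : Prop :=
  exists (s : R) A B, [/\ 0 < s, pref A B & forall x, v x = s * (A x - B x)].

Lemma pref_refl A : pref A A.
Proof. by case: (pref_total A A). Qed.

Lemma pref_mix p (p01 : 0 < p < 1) A B A' B' : pref A B -> pref A' B' ->
  pref (mix (weights_oo p01) A A') (mix (weights_oo p01) B B').
Proof.
move=> AB AB'; apply: (@pref_trans _ (mix (weights_oo p01) B A')).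
  exact/(pref_indep A B A' p01).
have q01 : 0 < 1 - p < 1 by lra.
have mixC C D : mix (weights_oo p01) C D = mix (weights_oo q01) D C.
  by apply: fdist_ext => x; rewrite !mixE; ring.
by rewrite !mixC; apply: (iffLR (pref_indep _ _ _ q01)).
Qed.

(** The cone does not depend on the chosen representatives: if [s (A - B) = s' (A' - B')], then
    [s A + s' B' = s' A' + s B]. After normalisation, mixing [A] and [B] with [B'] gives the same
    two lotteries as mixing [A'] and [B'] with [B], and independence applies on both sides. *)
Lemma cone_pref s A B : 0 < s -> cone (fun x => s * (A x - B x)) -> pref A B.
Proof.
move=> s0 [s' [A' [B' [s'0 AB' vE]]]].
have ss0 : s + s' != 0 by rewrite gt_eqF // addr_gt0.
have p01 : 0 < s / (s + s') < 1.
  by rewrite divr_gt0 ?addr_gt0 //= ltr_pdivrMr ?addr_gt0 // mul1r ltrDl.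
have q01 : 0 < s' / (s + s') < 1.
  by rewrite divr_gt0 ?addr_gt0 //= ltr_pdivrMr ?addr_gt0 // mul1r ltrDr.
apply/(pref_indep A B B' p01).
have -> : mix (weights_oo p01) A B' = mix (weights_oo q01) A' B.
  apply: fdist_ext => x; rewrite !mixE.
  transitivity ((s * (A x - B x) + s * B x + s' * B' x) / (s + s')).
    by field.
  by rewrite vE; field.
have -> : mix (weights_oo p01) B B' = mix (weights_oo q01) B' B.
  by apply: fdist_ext => x; rewrite !mixE; field.
by apply/(pref_indep A' B' B q01).
Qed.

Lemma coneP A B : cone (fun x => A x - B x) <-> pref A B.
Proof.
split=> [[s [A' [B' [s0 AB vE]]]]|AB].
  by apply: (@cone_pref 1) => //; exists s, A', B'; split=> // x; rewrite mul1r.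
by exists 1, A, B; split=> // x; rewrite mul1r.
Qed.

Lemma cone_ext v w : v =1 w -> cone v -> cone w.
Proof. by move=> vw [s [A [B [? ? vE]]]]; exists s, A, B; split=> // x; rewrite -vw. Qed.

Lemma cone0 : cone (fun=> 0).
Proof.
apply: cone_ext (proj2 (coneP (dirac R [::]) _) (pref_refl _)) => x.
by rewrite subrr.
Qed.

Lemma coneD v w : cone v -> cone w -> cone (fun x => v x + w x).
Proof.
move=> [s [A [B [s0 AB vE]]]] [s' [A' [B' [s'0 AB' wE]]]].
have ss0 : s + s' != 0 by rewrite gt_eqF // addr_gt0.
have p01 : 0 < s / (s + s') < 1.
  by rewrite divr_gt0 ?addr_gt0 //= ltr_pdivrMr ?addr_gt0 // mul1r ltrDl.
exists (s + s'), (mix (weights_oo p01) A A'), (mix (weights_oo p01) B B').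
split; [exact: addr_gt0|exact: pref_mix|move=> x].
by rewrite vE wE !mixE; field.
Qed.

Lemma coneZ c v : 0 <= c -> cone v -> cone (fun x => c * v x).
Proof.
rewrite le_eqVlt => /predU1P[<- _|c0 [s [A [B [s0 AB vE]]]]].
  by apply: cone_ext cone0 => x; rewrite mul0r.
by exists (c * s), A, B; split=> [|//|x]; rewrite ?mulr_gt0 // vE mulrA.
Qed.

(** Congruence modulo the lineality space of the cone; on lotteries it is indifference. *)
Definition ceq v w : Prop :=
  cone (fun x => v x - w x) /\ cone (fun x => w x - v x).

Lemma ceq_ext v w v' w' : v =1 v' -> w =1 w' -> ceq v w -> ceq v' w'.
Proof.
by move=> vv ww [vw wv]; split; [apply: cone_ext vw|apply: cone_ext wv] => x;
  rewrite vv ww.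
Qed.

Lemma ceq_refl v : ceq v v.
Proof. by split; apply: cone_ext cone0 => x; rewrite subrr. Qed.

Lemma ceq_sym v w : ceq v w -> ceq w v.
Proof. by case. Qed.

Lemma ceqD v w v' w' :
  ceq v w -> ceq v' w' -> ceq (fun x => v x + v' x) (fun x => w x + w' x).
Proof.
move=> [vw wv] [vw' wv'].
by split; [apply: cone_ext (coneD vw vw')|apply: cone_ext (coneD wv wv')] => x;
  ring.
Qed.

Lemma ceqZ c v w : ceq v w -> ceq (fun x => c * v x) (fun x => c * w x).
Proof.
move=> [vw wv]; have [c0|c0] := leP 0 c.
  by split; [apply: cone_ext (coneZ c0 vw)|apply: cone_ext (coneZ c0 wv)] => x;
    ring.
(* A negative scalar exchanges the two halves of the congruence. *)
have {}c0 : 0 <= - c by lra.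
by split; [apply: cone_ext (coneZ c0 wv)|apply: cone_ext (coneZ c0 vw)] => x;
  ring.
Qed.

Lemma ceq_trans v w z : ceq v w -> ceq w z -> ceq v z.
Proof.
move=> [vw wv] [wz zw].
by split; [apply: cone_ext (coneD vw wz)|apply: cone_ext (coneD wv zw)] => x;
  ring.
Qed.

Lemma ceq_sum (r : seq (seq T)) (v w : seq T -> seq T -> R) :
  (forall h, ceq (v h) (w h)) ->
  ceq (fun x => \sum_(h <- r) v h x) (fun x => \sum_(h <- r) w h x).
Proof.
move=> vw; elim: r => [|h r IHr].
  by apply: ceq_ext (ceq_refl (fun=> 0)) => x; rewrite big_nil.
by apply: ceq_ext (ceqD (vw h) IHr) => x; rewrite big_cons.
Qed.

Lemma ceqP A B : ceq A B <-> indiff pref A B.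
Proof. by split=> -[/coneP ? /coneP ?]. Qed.

(** * Coordinates along a strict preference *)

Section Coordinate.
Hypothesis pref_cont : continuity pref.
Variables a b : lottery R T.
Hypothesis nba : ~ pref b a.

Let e x : R := a x - b x.

(** If [c < 0], then [c * e] is a positive multiple of [b - a], and its membership in the cone would
    contradict strictness. *)
Lemma cone_e c : cone (fun x => c * e x) <-> 0 <= c.
Proof.
have ab : pref a b by case: (pref_total a b).
split=> [ce|c0]; last exact/coneZ/coneP.
rewrite leNgt; apply/negP => c0; apply/nba.
apply: (@cone_pref (- c)); first lra.
by apply: cone_ext ce => x; rewrite /e; ring.
Qed.

Lemma coordinate_inj c d : ceq (fun x => c * e x) (fun x => d * e x) -> c = d.
Proof.
have sub (s t : R) : cone (fun x => s * e x - t * e x) -> t <= s.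
  move=> st; rewrite -subr_ge0; apply/cone_e.
  by apply: cone_ext st => x; ring.
by move=> [/sub cd /sub dc]; apply/le_anti/andP.
Qed.

(** Continuity, applied to [a], [b], [C] in order of preference, makes the middle one indifferent to
    a mixture of the other two; this congruence is then solved for [C - b]. *)
Lemma coordinate_exists C : exists c, ceq (fun x => C x - b x) (fun x => c * e x).
Proof.
have ab : pref a b by case: (pref_total a b).
have [bC|Cb] := pref_total b C.
  have [p [p01 /ceqP pE]] := pref_cont ab bC.
  (* With weight 1 on [a] the mixture would be [a] itself, making [a] and [b] indifferent. *)
  have p1 : 1 - p != 0.
    apply/eqP => p1; apply/nba.
    have [_ /coneP] : ceq (mix (weights_cc p01) a C) b by [].
    have -> // : mix (weights_cc p01) a C = a.
    by apply: fdist_ext => x; rewrite mixE p1 mul0r addr0 (_ : p = 1) ?mul1r //; lra.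
  exists (- p / (1 - p)).
  (* The added term turns the two sides into [(1 - p) (C - b)] and [- p (a - b)]. *)
  have := ceqZ (1 - p)^-1 (ceqD pE (ceq_refl (fun x => - p * a x - (1 - p) * b x))).
  by apply: ceq_ext => x; rewrite ?mixE /e; field.
have [Ca|aC] := pref_total C a.
  have [p [p01 /ceqP pE]] := pref_cont Ca ab.
  have p0 : p != 0.
    apply/eqP => p0; apply/nba.
    have [/coneP + _] : ceq (mix (weights_cc p01) C b) a by [].
    have -> // : mix (weights_cc p01) C b = b.
    by apply: fdist_ext => x; rewrite mixE p0 mul0r add0r subr0 mul1r.
  exists p^-1; have := ceqZ p^-1 (ceqD pE (ceq_refl (fun x => - b x))).
  by apply: ceq_ext => x; rewrite ?mixE /e; field.
have [p [p01 /ceqP/ceq_sym pE]] := pref_cont aC Cb.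
exists p; have := ceqD pE (ceq_refl (fun x => - b x)).
by apply: ceq_ext => x; rewrite ?mixE /e; ring.
Qed.

End Coordinate.

Lemma expected_utility : continuity pref ->
  exists f : seq T -> R, forall A B, pref A B <-> expect f A >= expect f B.
Proof.
move=> pref_cont.
(* Without a strict preference all lotteries are indifferent, and a constant utility represents
   them. *)
have [[a [b nba]]|all_pref] := pselect (exists a b, ~ pref b a); last first.
  exists (fun=> 0) => A B; rewrite /expect.
  rewrite !big1 ?lexx; [|by move=> *; rewrite mulr0..].
  by split=> // _; apply: contrapT => nAB; apply: all_pref; exists B, A.
pose e x := a x - b x.
have [u uE] := choice (coordinate_exists pref_cont nba).
exists (fun h => u (dirac R h)).
(* Since [A] has mass 1, [A - b] is the average of the differences [h - b]; uniqueness of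
   coordinates makes [u A] the average of the utilities. *)
have u_expect A : u A = expect (fun h => u (dirac R h)) A.
  apply: (coordinate_inj nba); apply: ceq_trans (ceq_sym (uE A)) _.
  have := ceq_sum (finsupp A) (fun h => ceqZ (A h) (uE (dirac R h))).
  apply: ceq_ext => x; last by rewrite /expect mulr_suml; apply: eq_bigr => *; ring.
  under eq_bigr do rewrite mulrBr.
  by rewrite sumrB -fdist_dirac_sum -mulr_suml fdist_sum1 mul1r.
move=> A B; rewrite -!u_expect -subr_ge0.
have [AB BA] : ceq (fun x => A x - B x) (fun x => (u A - u B) * e x).
  have := ceqD (uE A) (ceqZ (- 1) (uE B)).
  by apply: ceq_ext => x; rewrite /e; ring.
split=> [/coneP pAB|uAB].
  by apply/(cone_e nba); apply: cone_ext (coneD BA pAB) => x; rewrite /e; ring.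
move/(cone_e nba) in uAB.
by apply/coneP; apply: cone_ext (coneD AB uAB) => x; rewrite /e; ring.
Qed.

End PositiveCone.

(** * Utility-reward pairs: equivalence with the axioms, and proportionality *)

Section UtilityReward.
Variables (R : realType) (T : countType).
Variable pref : lottery R T -> lottery R T -> Prop.
Variable gamma : T -> R.

Lemma utility_expect (u : lottery R T -> R) (r : T -> R) :
  utility_reward pref gamma u r ->
  forall A, u A = expect (fun h => u (dirac R h)) A.
Proof. by case. Qed.

Lemma utility_mix (u : lottery R T -> R) (r : T -> R) :
  utility_reward pref gamma u r ->
  forall p q (w : weights p q) A B, u (mix w A B) = p * u A + q * u B.
Proof. by move=> /utility_expect uE p q w A B; rewrite !uE expect_mix -!uE. Qed.

Lemma utility_prepend (u : lottery R T -> R) (r : T -> R) :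
  utility_reward pref gamma u r ->
  forall t A, u (prepend t A) = r t + gamma t * u A.
Proof.
move=> ur t A; rewrite !(utility_expect ur) expect_push.
rewrite -[r t]mul1r -(fdist_sum1 A) mulr_suml mulr_sumr -big_split /=.
by apply: eq_bigr => h _ /=; rewrite (utility_cons ur); ring.
Qed.

Lemma utility_indiff (u : lottery R T -> R) (r : T -> R) :
  utility_reward pref gamma u r ->
  forall A B, indiff pref A B <-> u A = u B.
Proof.
move=> ur A B; split=> [[/(utility_pref ur) BA /(utility_pref ur) AB]|AB].
  by apply/le_anti; rewrite AB.
by split; apply/(utility_pref ur); rewrite AB.
Qed.

Lemma utility_reward_axioms (gamma01 : forall t, 0 <= gamma t <= 1)
    (u : lottery R T -> R) (r : T -> R) :
  utility_reward pref gamma u r ->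
  [/\ completeness pref, transitivity pref, independence pref,
      continuity pref & temporal_indifference pref gamma01].
Proof.
move=> ur; have uP := utility_pref ur; have uI := utility_indiff ur.
have uM := utility_mix ur; split.
- by move=> A B; case: (leP (u A) (u B)) => [|/ltW] ?; [right|left]; apply/uP.
- by move=> A B C /uP BA /uP CB; apply/uP/(le_trans CB).
- move=> A B C p p01; rewrite !uP !uM lerD2r ler_pM2l //.
  by case/andP: p01.
- move=> A B C /uP BA /uP CB; have [CA|AC] := ltP (u C) (u A).
    (* The weight solves [p * u A + (1 - p) * u C = u B]. *)
    have p01 : 0 <= (u B - u C) / (u A - u C) <= 1.
      by rewrite divr_ge0 ?subr_ge0 ?(ltW CA) //= ler_pdivrMr ?subr_gt0 //; lra.
    exists _, p01; apply/uI; rewrite uM; field.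
    by rewrite subr_eq0 gt_eqF.
  (* Here the three utilities coincide, so any weight would do. *)
  have p01 : 0 <= (1 : R) <= 1 by lra.
  by exists 1, p01; apply/uI; rewrite uM; lra.
- move=> A B t w; apply/uI; rewrite !uM !(utility_prepend ur).
  by have /andP[g0 _] := gamma01 t; field; rewrite gt_eqF // ltr_wpDl.
Qed.

Lemma axioms_utility_reward (gamma01 : forall t, 0 <= gamma t <= 1) :
  completeness pref -> transitivity pref -> independence pref ->
  continuity pref -> temporal_indifference pref gamma01 ->
  exists (u : lottery R T -> R) (r : T -> R), utility_reward pref gamma u r.
Proof.
move=> tot trans indep cont temporal.
have [f fP] := expected_utility tot trans indep cont.
have fI A B : indiff pref A B -> expect f A = expect f B.
  by move=> [/fP BA /fP AB]; apply/le_anti; rewrite AB.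
(* Shifting [f] to vanish at the empty history moves every expectation by the same constant, hence
   preserves preferences. The recursion at the empty history then forces the reward of [t] to be [g
   [:: t]]. *)
pose g h := f h - f [::].
have gE A : expect g A = expect f A - f [::].
  rewrite -[f [::] in RHS]mul1r -(fdist_sum1 A) mulr_suml -sumrB.
  by apply: eq_bigr => h _; rewrite mulrBr.
exists (expect g), (fun t => g [:: t]); split.
- by rewrite expect_dirac /g subrr.
- move=> t h; rewrite !expect_dirac /g.
  (* Cleared of the denominator, this reads [f (t :: h) + gamma t * f [::] = f [:: t] + gamma t * f
     h]. *)
  have /fI := temporal (dirac R h) (dirac R [::]) t.
  rewrite !expect_mix !prepend_dirac !expect_dirac.
  have /andP[g0 _] := gamma01 t; have g1 : gamma t + 1 != 0.
    by rewrite gt_eqF // ltr_wpDl.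
  move=> /eqP; rewrite -subr_eq0 => /eqP E; apply/eqP; rewrite -subr_eq0; apply/eqP.
  by rewrite -[RHS](mulr0 (gamma t + 1)) -E; field.
- by move=> A B; rewrite fP !gE lerD2r.
- by move=> A; apply: eq_bigr => h _; rewrite expect_dirac.
Qed.

(** The cross-multiplied form also covers lotteries of utility zero. *)
Lemma utility_proportional (u u' : lottery R T -> R) (r r' : T -> R) :
  utility_reward pref gamma u r -> utility_reward pref gamma u' r' ->
  forall A B, u A * u' B = u B * u' A.
Proof.
move=> ur ur' A B.
have uu' C D : u C = u D -> u' C = u' D.
  by move/(utility_indiff ur)/(utility_indiff ur').
have [d0|d0] := eqVneq (`|u A| + `|u B|) 0.
  have /andP[/eqP-> /eqP->] : (u A == 0) && (u B == 0).
    by rewrite -(normr_eq0 (u A)) -(normr_eq0 (u B)) -paddr_eq0 // d0.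
  by rewrite !mul0r.
set S := `|u A| + `|u B| in d0.
(* [s] is the sign of [u A], taken as 1 at zero; [u B] has either that sign or the opposite one. *)
have [s [s0 aE bE]] : exists s : R, [/\ s != 0, `|u A| = s * u A &
    `|u B| = s * u B \/ `|u B| = - s * u B].
  exists ((-1) ^+ (u A < 0)%R); split; rewrite ?signr_eq0 -?normrEsign //.
  rewrite (normrEsign (u B)).
  by case: (u A < 0); case: (u B < 0); rewrite ?expr0 ?expr1 ?opprK; auto.
pose n := dirac R ([::] : seq T).
pose p := `|u A| / S; pose q := `|u B| / S.
have wpq : weights p q.
  by rewrite /weights !divr_ge0 ?addr_ge0 //= -mulrDl divff.
have wqp : weights q p by case/and3P: wpq => p0 q0; rewrite addrC /weights p0 q0.
(* For equal signs, [p * u B = q * u A] makes the first two mixtures indifferent; for opposite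
   signs, [p * u B + q * u A = 0] makes the mixture of [B] and [A] indifferent to the empty
   history. *)
have := uu' (mix wpq B n) (mix wqp A n); have := uu' (mix wpq B A) n.
rewrite !(utility_mix ur) !(utility_mix ur') !(utility_nil ur) !(utility_nil ur').
have sS : s / S != 0 by rewrite mulf_neq0 ?invr_eq0.
rewrite !mulr0 !addr0 /p /q aE; case: bE => -> opp same; apply: (mulfI sS).
  by transitivity (s * u A / S * u' B); [|rewrite same]; ring.
apply/eqP; rewrite -subr_eq0; apply/eqP.
by rewrite -[RHS]opp; ring.
Qed.

End UtilityReward.

Theorem theorem4p1 (R : realType) (T : countType)
    (pref : lottery R T -> lottery R T -> Prop)
    (gamma : T -> R) (gamma01 : forall t, 0 <= gamma t <= 1) :
  ([/\ completeness pref, transitivity pref, independence pref,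
       continuity pref & temporal_indifference pref gamma01]
   <-> exists (u : lottery R T -> R) (r : T -> R),
         utility_reward pref gamma u r)
  /\ (forall (u u' : lottery R T -> R) (r r' : T -> R),
        utility_reward pref gamma u r -> utility_reward pref gamma u' r' ->
        exists c : R, 0 < c /\ forall t, r' t = c * r t).
Proof.
split; first split.
- by case; apply: axioms_utility_reward.
- by move=> [u [r]]; apply: utility_reward_axioms.
move=> u u' r r' ur ur'.
(* Rewards are utilities of one-step histories, so proportional utilities give proportional
   rewards. *)
have rE v s : utility_reward pref gamma v s -> forall t, s t = v (dirac R [:: t]).
  by move=> vs t; rewrite (utility_cons vs) (utility_nil vs) mulr0 addr0.
(* If [u] vanishes everywhere, all lotteries are indifferent and both rewards are zero. *)
have [[A uA]|u0] := pselect (exists A, u A != 0); last first.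
  exists 1; split=> // t; rewrite mul1r (rE _ _ ur) (rE _ _ ur').
  have uz : u (dirac R [:: t]) = 0.
    by apply/eqP; apply: contrapT => /negP nz; apply: u0; exists (dirac R [:: t]).
  rewrite uz -(utility_nil ur'); apply/(utility_indiff ur')/(utility_indiff ur).
  by rewrite uz (utility_nil ur).
exists (u' A / u A); split; last first.
  move=> t; rewrite (rE _ _ ur) (rE _ _ ur').
  have := utility_proportional ur ur' A (dirac R [:: t]).
  by move=> AtE; apply: (mulfI uA); rewrite AtE; field.
(* Comparing [A] with the empty history, where both utilities vanish, shows that [u A] and [u' A]
   have the same sign. *)
have sgnE (C D : lottery R T) : (u C <= u D) = (u' C <= u' D).
  by apply/idP/idP => [/(utility_pref ur)/(utility_pref ur')|
                       /(utility_pref ur')/(utility_pref ur)].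
have := sgnE A (dirac R [::]); have := sgnE (dirac R [::]) A.
rewrite (utility_nil ur) (utility_nil ur') => pos neg.
case: (ltgtP (u A) 0) uA => // uA _.
  by rewrite nmulr_rgt0 ?invr_lt0 // ltNge -pos -ltNge.
by rewrite divr_gt0 // ltNge -neg -ltNge.
Qed.
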